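(* Let $G$ be a finite simple graph, let $n\ge 0$ be even, let $v_1,\dots,v_n$ be (not necessarily distinct) vertices of $G$, and let $\{u,v\}\in E(G)$. Then $\mathrm{pm}_{G[uv]}(v_1,\dots,v_n)=\mathrm{pm}_G(v_1,\dots,v_n,u,v)$.
   Context: $x\sim_H y$ holds iff $\{x,y\}\in E(H)$ or $x=y$. For an even $m\ge0$ and (not necessarily distinct) vertices $w_1,\dots,w_m$, $\mathrm{pm}_H(w_1,\dots,w_m)=\bigoplus_P\bigwedge_{\{i,j\}\in P}(w_i\sim_H w_j)$, $P$ ranging over partitions of $\{1,\dots,m\}$ into 2-element sets ($\oplus$ = exclusive or; value true for $m=0$). Pivot: with $N'(x)=N(x)\cup\{x\}$, $V_1=N'(u)\setminus N'(v)$, $V_2=N'(v)\setminus N'(u)$, $V_3=N'(u)\cap N'(v)$, the graph $G[uv]$ is obtained from $G$ by toggling every pair $\{x,y\}$ with $x\in V_i$, $y\in V_j$, $i\neq j$. *)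

(* Defs.v *)
From mathcomp Require Import all_boot.

Set Implicit Arguments.
Unset Strict Implicit.
Unset Printing Implicit Defensive.

(* The finite simple graphs with vertex set V. *)
Record sgraph (V : finType) := SGraph {
  edge : rel V;
  edge_sym : symmetric edge;
  edge_irr : irreflexive edge }.

Definition adjeq (V : finType) (H : sgraph V) : rel V :=
  fun x y => edge H x y || (x == y).

Definition pairing (m : nat) (P : {set {set 'I_m}}) : bool :=
  partition P [set: 'I_m] && [forall B in P, #|B| == 2].

(* Defined for every m: for odd m there is no pairing and the value is false.
   The blocks of a pairing P have two elements, so [set i; j] \in P forces
   i != j. *)
Definition pm (V : finType) (H : sgraph V) (m : nat) (w : m.-tuple V) : bool :=
  \big[addb/false]_(P : {set {set 'I_m}} | pairing P)
    [forall i, forall j,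
       ([set i; j] \in P) ==> adjeq H (tnth w i) (tnth w j)].

Section Pivot.

Variables (V : finType) (G : sgraph V) (u v : V).

Definition closed_nbhd (x : V) : {set V} := x |: [set y | edge G x y].

Definition pivot_class (i : 'I_3) : {set V} :=
  nth set0 [:: closed_nbhd u :\: closed_nbhd v;
               closed_nbhd v :\: closed_nbhd u;
               closed_nbhd u :&: closed_nbhd v] i.

Definition pivot_toggle : rel V := fun x y =>
  [exists i, exists j,
     [&& i != j, x \in pivot_class i & y \in pivot_class j]].

Definition pivot_edge : rel V := fun x y => edge G x y (+) pivot_toggle x y.

Lemma pivot_edge_sym : symmetric pivot_edge.
Proof.
suff tS x y : pivot_toggle x y -> pivot_toggle y x.
  by move=> x y; rewrite /pivot_edge edge_sym; congr addb; apply/idP/idP => /tS.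
case/existsP=> i /existsP[j /and3P[nij xi yj]].
by apply/existsP; exists j; apply/existsP; exists i; rewrite eq_sym nij yj xi.
Qed.

Lemma pivot_edge_irr : irreflexive pivot_edge.
Proof.
move=> x; rewrite /pivot_edge edge_irr /=; apply/existsP => -[i /existsP[j]].
case: i j => [[|[|[|//]]] ?] [[|[|[|//]]] ?];
  rewrite /pivot_class /= ?in_setD ?in_setI -?val_eqE //=;
  by case: (x \in closed_nbhd u); case: (x \in closed_nbhd v).
Qed.

Definition pivot : sgraph V := SGraph pivot_edge_sym pivot_edge_irr.

End Pivot.

(* Main.v *)
(* Over F_2 the exclusive or over all pairings is a Pfaffian of the matrix b
   with entries b i j = (w_i ~ w_j), i != j, and pivoting on uv replaces b x y by
   b x y + b x u * b v y + b x v * b u y, that is, takes the Schur complement of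
   the block {u, v}; the identity says that this complement has the Pfaffian of
   the full matrix.  Expanding along a point x of the index set, it follows by
   induction once sum_y b v y * Pf (u, v, S - y) is known to be Pf (v, S).
   Expanding that sum along u, the terms with u matched to v give Pf (v, S) and
   the others cancel. *)

Require Import Defs.
From mathcomp Require Import all_boot.

Set Implicit Arguments.
Unset Strict Implicit.
Unset Printing Implicit Defensive.

(** * Pairings of a subset and expansion of their Pfaffian along a point *)

Definition pairing_of (I : finType) (A : {set I}) (P : {set {set I}}) : bool :=
  partition P A && [forall B in P, #|B| == 2].

Definition pairing_wt (I : finType) (b : rel I) (P : {set {set I}}) : bool :=
  [forall i, forall j, ([set i; j] \in P) ==> b i j].

(** Working with subsets [A] of one fixed index type lets inductions remove points without changing
    the type; for the full set, [pm] is recovered by conversion. *)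
Definition pf (I : finType) (b : rel I) (A : {set I}) : bool :=
  \big[addb/false]_(P | pairing_of A P) pairing_wt b P.

Lemma pf_set0 (I : finType) (b : rel I) : pf b set0.
Proof.
rewrite /pf (big_pred1 set0) => [|P].
  by apply/forallP => i; apply/forallP => j; rewrite inE.
rewrite /pairing_of partition_set0 /= andbC; case: eqP => [->|]; last first.
  by rewrite andbF.
by rewrite andbT; apply/forallP => B; rewrite inE.
Qed.

Lemma pairing_of_card (I : finType) (A B : {set I}) P :
  pairing_of A P -> B \in P -> #|B| = 2.
Proof. by case/andP => _ /forall_inP/[apply]/eqP. Qed.

Lemma pairing_of_mate (I : finType) (A : {set I}) P x :
  pairing_of A P -> x \in A -> exists2 y, y \in A :\ x & [set x; y] \in P.
Proof.
move=> pairP xA; have /andP[partP _] := pairP.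
have xP : x \in cover P by rewrite (cover_partition partP).
have BP := pblock_mem xP; have xB : x \in pblock P x by rewrite mem_pblock.
have sBA := partitionS partP BP.
have /eqP/cards2P[y [z [nyz defB]]] := pairing_of_card pairP BP.
move: xB sBA BP; rewrite defB => /set2P[] -> sBA BP.
  exists z => //; rewrite in_setD1 eq_sym nyz; apply: (subsetP sBA).
  exact: set22.
exists y; last by rewrite setUC.
by rewrite in_setD1 nyz; apply: (subsetP sBA); exact: set21.
Qed.

Lemma pairing_of_mate_uniq (I : finType) (A : {set I}) P x y z :
  pairing_of A P -> x != y -> [set x; y] \in P -> [set x; z] \in P -> y = z.
Proof.
case/andP => /and3P[_ tiP _] _ nxy yP zP.
have : y \in [set x; z].
  rewrite -(def_pblock tiP zP (set21 x z)) (def_pblock tiP yP (set21 x y)).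
  exact: set22.
by case/set2P => // yx; rewrite yx eqxx in nxy.
Qed.

(** Adding a block forgets whether [P] already contained it; the conjunct [[set x; y] \notin P]
    restores this, so that the equality holds for every [P] and can serve to reindex a sum. *)
Lemma pairing_ofU (I : finType) (A : {set I}) P x y :
    x != y -> x \notin A -> y \notin A ->
  pairing_of ([set x; y] :|: A) ([set x; y] |: P) && ([set x; y] \notin P)
    = pairing_of A P.
Proof.
move=> nxy xA yA.
have dis : [disjoint [set x; y] & A].
  by rewrite disjoints_subset; apply/subsetP=> z; rewrite !inE => /pred2P[]->.
have notP : pairing_of A P -> [set x; y] \notin P.
  case/andP=> partP _; apply: contra xA => /(partitionS partP)/subsetP; apply.
  exact: set21.
apply/andP/idP => [[pairP nP]|pairP].
  have /andP[partP cardP] := pairP; apply/andP; split.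
    have := partitionD1 partP (setU11 _ _); rewrite setU1K // setDUl setDv set0U.
    by rewrite (setDidPl _) // disjoint_sym.
  by apply/forall_inP => B BP; apply: (forall_inP cardP); rewrite setU1r.
split; last exact: notP.
have /andP[partP cardP] := pairP; apply/andP; split.
  by apply: partitionU1 => //; apply/set0Pn; exists x; exact: set21.
apply/forall_inP => B /setU1P[->|BP]; first by rewrite cards2 nxy.
exact: (forall_inP cardP).
Qed.

Lemma set2_eq (I : finType) (x y i j : I) :
  [set i; j] = [set x; y] -> (i = x /\ j = y) \/ (i = y /\ j = x).
Proof.
move=> e.
have [ixy jxy] : i \in [set x; y] /\ j \in [set x; y] by rewrite -e set21 set22.
have [xij yij] : x \in [set i; j] /\ y \in [set i; j] by rewrite e set21 set22.
by case/set2P: ixy; case/set2P: jxy; case/set2P: xij; case/set2P: yij;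
  move=> *; subst; auto.
Qed.

Lemma pairing_wtU (I : finType) (b : rel I) P x y :
  symmetric b -> pairing_wt b ([set x; y] |: P) = b x y && pairing_wt b P.
Proof.
move=> b_sym; apply/idP/andP => [wtP|[bxy wtP]].
  split.
    by have /forallP/(_ x)/forallP/(_ y)/implyP := wtP; apply; exact: setU11.
  apply/forallP => i; apply/forallP => j; apply/implyP => ijP.
  by have /forallP/(_ i)/forallP/(_ j)/implyP := wtP; apply; exact: setU1r.
apply/forallP => i; apply/forallP => j; apply/implyP => /setU1P[|ijP].
  by case/set2_eq=> -[-> ->] //; rewrite b_sym.
by have /forallP/(_ i)/forallP/(_ j)/implyP := wtP; apply.
Qed.

(** Pairings are sorted by the mate [y] of [x]; deleting the block [[set x; y]] is a bijection onto
    the pairings of [A :\ y]. *)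
Lemma pf_setU1 (I : finType) (b : rel I) (A : {set I}) x :
    symmetric b -> x \notin A ->
  pf b (x |: A) = \big[addb/false]_(y in A) (b x y && pf b (A :\ y)).
Proof.
move=> b_sym xA.
(* The default [x] is never reached on a pairing of [x |: A]. *)
pose mate (P : {set {set I}}) := odflt x [pick y in A | [set x; y] \in P].
have mateP P : pairing_of (x |: A) P -> (mate P \in A) && ([set x; mate P] \in P).
  move=> /pairing_of_mate/(_ (setU11 _ _))[y]; rewrite setU1K // => yA yP.
  by rewrite /mate; case: pickP => //= /(_ y); rewrite yA yP.
rewrite /pf (partition_big mate [in A]) => [|P /mateP/andP[]//].
apply: eq_bigr => y yA; have nxy : x != y by apply: contraNneq xA => ->.
have xyA : x |: A = [set x; y] :|: A :\ y by rewrite -setUA setD1K.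
rewrite big_distrr /= (reindex_onto (fun P => [set x; y] |: P)
  (fun P => P :\ [set x; y])) => [|P /andP[pairP /eqP<-]]; last first.
  by rewrite setD1K //; case/andP: (mateP P pairP).
apply: eq_big => [P|P _]; last exact: pairing_wtU.
rewrite -(pairing_ofU P nxy) ?in_setD1 ?(negPf xA) ?andbF ?eqxx // -xyA -andbA.
apply: andb_id2l => pairP.
have -> : mate ([set x; y] |: P) == y.
  have /andP[_ mP] := mateP _ pairP.
  by apply/eqP/esym; apply: pairing_of_mate_uniq pairP nxy (setU11 _ _) mP.
by apply/eqP/idP => [<-|]; [rewrite setD11 | exact: setU1K].
Qed.

Lemma pf_setD1 (I : finType) (b : rel I) (A : {set I}) x :
    symmetric b -> x \in A ->
  pf b A = \big[addb/false]_(y in A :\ x) (b x y && pf b (A :\ x :\ y)).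
Proof. by move=> b_sym xA; rewrite -pf_setU1 ?setD11 // setD1K. Qed.

(** * Cancellations in double sums over F_2 *)

Lemma exchange_big_setD1 (I : finType) (S : {set I}) (F : I -> I -> bool) :
  \big[addb/false]_(i in S) \big[addb/false]_(j in S :\ i) F i j =
  \big[addb/false]_(j in S) \big[addb/false]_(i in S :\ j) F i j.
Proof.
rewrite (exchange_big_dep [in S]) /= => [|i j _ /setD1P[]//].
apply: eq_bigr => j jS; apply: eq_bigl => i; rewrite !inE jS andbT eq_sym.
exact: andbC.
Qed.

Lemma big_addb_sym (I : finType) (S : {set I}) (F : I -> I -> bool) :
    (forall i j, F i j = F j i) ->
  \big[addb/false]_(i in S) \big[addb/false]_(j in S :\ i) F i j = false.
Proof.
move=> F_sym; elim: {S}_.+1 {-2}S (ltnSn #|S|) => // n IHn S leSn.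
have [->|[x xS]] := set_0Vmem S; first by rewrite big_set0.
rewrite (big_setD1 x) //=.
(* By symmetry the column of [x] equals its row, so the two cancel and the double sum over [S :\ x]
   remains. *)
under [X in _ (+) X]eq_bigr => i /setD1P[nix iS].
  rewrite (big_setD1 x) ?inE 1?eq_sym ?nix //= F_sym setDDl setUC -setDDl.
  over.
rewrite big_split /= IHn ?addbF ?addbb //.
by rewrite (cardsD1 x) xS in leSn.
Qed.

Lemma setU1D1 (I : finType) (S : {set I}) x y :
  x != y -> (x |: S) :\ y = x |: S :\ y.
Proof.
move=> nxy; apply/setP=> z; rewrite !inE; have [->|//] := eqVneq z y.
by rewrite orbF eq_sym (negPf nxy).
Qed.

(* The sum is what remains of the Pfaffian with the index v repeated once the two
   copies of v are not matched to each other; swapping their mates cancels it. *)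
Lemma pf_alternating (I : finType) (b : rel I) (S : {set I}) v :
    symmetric b -> v \notin S ->
  \big[addb/false]_(y in S) (b v y && pf b (v |: S :\ y)) = false.
Proof.
move=> b_sym vS.
rewrite -[RHS](big_addb_sym S (F := fun y z =>
  [&& b v y, b v z & pf b (S :\: [set y; z])])); last first.
  by move=> y z; rewrite setUC andbCA.
apply: eq_bigr => y yS; rewrite pf_setU1 ?inE ?(negPf vS) ?andbF // big_distrr.
by apply: eq_bigr => z _ /=; rewrite setDDl.
Qed.

Lemma pf_contract (I : finType) (b : rel I) (S : {set I}) u v :
    symmetric b -> u != v -> b u v -> u \notin S -> v \notin S ->
  \big[addb/false]_(y in S) (b v y && pf b (u |: (v |: S :\ y))) = pf b (v |: S).
Proof.
move=> b_sym nuv buv uS vS.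
(* The first summand matches [u] to [v], the second matches [u] to some [z] in [S :\ y]. *)
rewrite (eq_bigr (fun y => (b v y && pf b (S :\ y)) (+)
    \big[addb/false]_(z in S :\ y) (b v y && (b u z && pf b (v |: S :\ z :\ y)))))
  => [|y yS]; last first.
  rewrite pf_setU1 ?inE ?(negPf nuv) ?(negPf uS) ?andbF //.
  rewrite big_setU1 ?inE ?(negPf vS) ?andbF //= buv setU1K; last first.
    by rewrite !inE (negPf vS) andbF.
  rewrite andb_addr andTb; congr addb; rewrite big_distrr.
  apply: eq_bigr => z /setD1P[_ zS].
  rewrite setU1D1 ?(memPnC vS) //; do 2 congr (_ && _).
  by rewrite setDDl [[set y] :|: _]setUC -setDDl.
rewrite big_split /= -pf_setU1 // exchange_big_setD1.
(* For a fixed mate [z] of [u], the sum over [y] is an instance of [pf_alternating] on [S :\ z]. *)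
rewrite [X in _ (+) X]big1 ?addbF // => z zS.
under eq_bigr do rewrite andbCA.
by rewrite -big_distrr /= pf_alternating ?andbF // !inE (negPf vS) andbF.
Qed.

(** * The Pfaffian of the Schur complement *)

Lemma pf_pivot (I : finType) (b c : rel I) (u v : I) (A : {set I}) :
    symmetric b -> symmetric c -> u != v -> b u v -> u \notin A -> v \notin A ->
    {in A &, forall x y, x != y ->
      c x y = b x y (+) (b x u && b v y) (+) (b x v && b u y)} ->
  pf c A = pf b (u |: (v |: A)).
Proof.
move=> b_sym c_sym nuv buv; elim: {A}_.+1 {-2}A (ltnSn #|A|) => // n IHn A.
have [-> _ _ _ _|[x xA]] := set_0Vmem A.
  rewrite pf_set0 setU0 pf_setU1 ?inE // big_set1 buv setDv.
  by rewrite pf_set0.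
rewrite ltnS (cardsD1 x) xA add1n => ltAn uA vA cE.
have [S [xS defA]] : exists S : {set I}, x \notin S /\ A = x |: S.
  by exists (A :\ x); rewrite setD11 setD1K.
move: uA vA ltAn cE; rewrite {}defA {xA} setU1K // !inE !negb_or.
move=> /andP[nux uS] /andP[nvx vS] ltSn cE.
have -> : u |: (v |: (x |: S)) = x |: (u |: (v |: S)).
  by rewrite !setUA -!(setUC [set x]) !setUA.
rewrite !pf_setU1 ?inE ?negb_or 1?[x == _]eq_sym ?nux ?[x == _]eq_sym ?nvx //.
rewrite big_setU1 ?inE ?negb_or ?nuv //= big_setU1 //=.
rewrite setU1K ?inE ?negb_or ?nuv //.
have -> : (u |: (v |: S)) :\ v = u |: S.
  by rewrite setUCA setU1K // !inE negb_or eq_sym nuv.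
(* The terms with [x] matched to [u] or to [v] become sums over [y] in [S] as well, the second with
   the roles of [u] and [v] exchanged. All terms then share the factor [pf b (u |: (v |: S :\ y))],
   and the coefficients are compared for each [y]. *)
rewrite -(pf_contract b_sym nuv buv uS vS).
rewrite -(pf_contract b_sym _ _ vS uS) 1?eq_sym 1?b_sym //.
rewrite !big_distrr -!big_split /=; apply: eq_bigr => y yS.
have nyx : x != y by apply: contraNneq xS => ->.
rewrite cE ?setU11 ?setU1r // IHn; last first.
- move=> s t /setD1P[_ sS] /setD1P[_ tS]; apply: cE; exact: setU1r.
- by rewrite !inE (negPf vS) andbF.
- by rewrite !inE (negPf uS) andbF.
- by rewrite (leq_ltn_trans _ ltSn) // subset_leq_card // subD1set.
have -> : (u |: (v |: S)) :\ y = u |: (v |: S :\ y).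
  by rewrite !setU1D1 // eq_sym ?(memPn uS) ?(memPn vS).
rewrite [v |: (u |: _)]setUCA (b_sym u x).
by case: (pf b _); rewrite ?andbT ?andbF // -addbA addbC -addbA.
Qed.

(** * Transfer to tuples of vertices and to the pivoted graph *)

Lemma pf_imset (I J : finType) (f : I -> J) (c : rel I) (b : rel J) (A : {set I}) :
    injective f -> symmetric b ->
    (forall x y, c x y = b (f x) (f y)) ->
  pf b (f @: A) = pf c A.
Proof.
move=> f_inj b_sym cE.
have c_sym : symmetric c by move=> x y; rewrite !cE b_sym.
(* Induction through the expansion along a point avoids transporting set partitions along [f]. *)
elim: {A}_.+1 {-2}A (ltnSn #|A|) => // n IHn A.
have [-> _|[x xA]] := set_0Vmem A; first by rewrite imset0 !pf_set0.
have imD1 (B : {set I}) y : f @: B :\ f y = f @: (B :\ y).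
  apply/setP=> z; rewrite !inE.
  apply/andP/idP => [[nz /imsetP[t tB zE]]|/imsetP[t]].
    by rewrite zE in nz *; rewrite imset_f // !inE tB andbT -(inj_eq f_inj).
  by case/setD1P=> nty tB ->; rewrite (inj_eq f_inj) imset_f.
rewrite ltnS (cardsD1 x) xA add1n => ltAn.
rewrite (pf_setD1 b_sym (imset_f f xA)) (pf_setD1 c_sym xA) imD1.
rewrite big_imset /=; last exact: in2W.
apply: eq_bigr => y _; rewrite -cE imD1 IHn //.
by rewrite (leq_ltn_trans _ ltAn) // subset_leq_card // subD1set.
Qed.

Lemma pm_pf (V : finType) (H : sgraph V) m (w : m.-tuple V) :
  pm H w = pf (fun i j => adjeq H (tnth w i) (tnth w j)) [set: 'I_m].
Proof. by []. Qed.

Lemma adjeq_sym (V : finType) (H : sgraph V) : symmetric (adjeq H).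
Proof. by move=> x y; rewrite /adjeq edge_sym eq_sym. Qed.

(** Membership in the closed neighbourhoods of [u] and [v] gives each vertex a vector in F_2^2, and
    the three classes are the three nonzero vectors. A pair is toggled iff its vectors are nonzero
    and distinct, that is, iff their determinant is 1. For [x = y] the determinant vanishes, in
    accordance with [adjeq] being reflexive. *)
Lemma adjeq_pivot (V : finType) (G : sgraph V) (u v x y : V) :
  adjeq (pivot G u v) x y = adjeq G x y (+) (adjeq G x u && adjeq G v y)
                              (+) (adjeq G x v && adjeq G u y).
Proof.
have nbhdE z t : (t \in closed_nbhd G z) = adjeq G z t.
  by rewrite !inE orbC eq_sym.
have tE : pivot_toggle G u v x y =
    (adjeq G x u && adjeq G v y) (+) (adjeq G x v && adjeq G u y).
  rewrite ![adjeq G x _]adjeq_sym -!nbhdE.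
  have exE (p : pred 'I_3) : [exists i, p i] = \big[orb/false]_i p i.
    by rewrite big_orE; apply: eq_existsb.
  rewrite /pivot_toggle exE !big_ord_recl big_ord0 !exE.
  rewrite !big_ord_recl !big_ord0 /pivot_class /= !(in_setD, in_setI).
  by do 4 case: (_ \in _).
rewrite -addbA -tE; have [exy|nxy] := eqVneq x y; last first.
  by rewrite /adjeq (negPf nxy) !orbF.
rewrite tE -exy !(adjeq_sym G x) /adjeq eqxx !orbT.
by case: (_ || _); case: (_ || _).
Qed.

Theorem theorem9 (V : finType) (G : sgraph V) (n : nat) (hn : ~~ odd n)
    (w : n.-tuple V) (u v : V) (huv : edge G u v) :
  pm (pivot G u v) w = pm G [tuple of w ++ [:: u; v]].
Proof.
set t := [tuple of w ++ _]; rewrite !pm_pf.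
set b := fun i j : 'I_(n + 2) => _.
(* The pivoted relation is extended to all [n + 2] positions, since [pf_pivot] compares two
   relations on the same index type. *)
pose c i j := adjeq (pivot G u v) (tnth t i) (tnth t j).
have b_sym : symmetric b by move=> i j; exact: adjeq_sym.
have c_sym : symmetric c by move=> i j; exact: adjeq_sym.
(* The two appended positions are distinct from all others even when [u] or [v] occurs in [w]. *)
pose iu : 'I_(n + 2) := rshift n ord0; pose iv : 'I_(n + 2) := rshift n ord_max.
have tu : tnth t iu = u by rewrite tnth_rshift.
have tv : tnth t iv = v by rewrite tnth_rshift.
(* This yields both the splitting of the index set and the non-membership conditions of
   [pf_pivot]. *)
have iuvN k : k \notin lshift 2 @: [set: 'I_n] = (k == iu) || (k == iv).
  case: (split_ordP k) => [i|j] ->; first by rewrite imset_f // !eq_lrshift.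
  rewrite !eq_rshift; case: imsetP => [[i _ /eqP]|_]; first by rewrite eq_rlshift.
  by case: j => [[|[|//]] ?].
have defT : [set: 'I_(n + 2)] = iu |: (iv |: lshift 2 @: [set: 'I_n]).
  apply/setP=> k; rewrite !inE; apply/esym.
  by rewrite orbA -iuvN orNb.
rewrite defT -(pf_imset (f := lshift 2) (b := c)) //.
- apply: pf_pivot => //; rewrite ?iuvN ?eqxx ?orbT ?eq_rshift //.
    by rewrite /b tu tv /adjeq huv.
  by move=> i j _ _ _; rewrite /b /c tu tv adjeq_pivot.
- exact: lshift_inj.
- by move=> i j; rewrite /c !tnth_lshift.
Qed.
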